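(* For any $d \in \mathbb{N}$ there exists a finitely generated virtually abelian group $G$ such that for every $c \in \mathbb{N}$ with $c \leq d$, there is a conjugacy class $C$ of $G$ with growth equivalent to $n^c$, that is, $\beta_{C,S}(n) \sim n^c$ for any finite generating set $S$ of $G$.
   Context: $\mathbb{N} = \{0,1,2,\ldots\}$. A group is virtually abelian if it has a finite-index abelian subgroup. Let $G$ be a group with finite generating set $S$. For $g \in G$, $\ell_S(g)$ is the minimal length of a word over $S \cup S^{-1}$ (including the empty word) representing $g$. For $U \subseteq G$, the growth function of $U$ in $G$ is $\beta_{U,S}(n) = |\{g \in U : \ell_S(g) \leq n\}|$ for $n\in\mathbb{N}$. For $f,g \colon \mathbb{N} \to \mathbb{N}$ write $f \preccurlyeq g$ if there is an integer $\lambda \geq 1$ such that $f(n) \leq \lambda g(\lambda n + \lambda) + \lambda$ for all $n \in \mathbb{N}$, and $f \sim g$ (equivalent) if $f \preccurlyeq g$ and $g \preccurlyeq f$. Up to equivalence, the growth function of a subset does not depend on the choice of finite generating set. By convention $n^0 = 1$. *)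

(* Defs.v *)
From mathcomp Require Import all_boot.
From mathcomp Require Import finmap boolp classical_sets functions cardinality.

Set Implicit Arguments.
Unset Strict Implicit.
Unset Printing Implicit Defensive.

Local Open Scope classical_set_scope.
Local Open Scope group_scope.

Section Groups.
Variable G : groupType.
Implicit Types (H U C : set G) (S : {fset G}) (g x : G) (w : seq G).

Definition is_word S w : Prop := forall x, x \in w -> x \in S \/ x^-1 \in S.

Definition represents w g : Prop := \prod_(x <- w) x = g.

Definition has_word_of_size S g (n : nat) : Prop :=
  exists w, [/\ is_word S w, represents w g & size w = n].

Definition generates S : Prop := forall g, exists n, has_word_of_size S g n.

Definition finitely_generated : Prop := exists S, generates S.

(* The junk value 0%N is never reached when S generates G. *)
Definition word_length S g : nat :=
  if pselect (exists n, `[< has_word_of_size S g n >]) is left ex_word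
  then ex_minn ex_word else 0%N.

(* When S generates G, the set below is finite, so that fset_set is faithful
   (it would return the empty fset on an infinite set). *)
Definition growth U S (n : nat) : nat :=
  #|` fset_set [set g | U g /\ (word_length S g <= n)%N] |.

Definition is_subgroup H : Prop := group_closed (mem H).

Definition is_abelian H : Prop := forall x y, H x -> H y -> commute x y.

Definition left_coset x H : set G := [set x * h | h in H].

Definition finite_index H : Prop :=
  finite_set [set left_coset x H | x in [set: G]].

Definition virtually_abelian : Prop :=
  exists H, [/\ is_subgroup H, is_abelian H & finite_index H].

Definition is_conjugacy_class C : Prop :=
  exists x, C = [set x ^ g | g in [set: G]].

End Groups.

Arguments finitely_generated : clear implicits.
Arguments virtually_abelian : clear implicits.

Definition growth_le (f g : nat -> nat) : Prop :=
  exists2 l : nat, (1 <= l)%N &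
    forall n : nat, (f n <= l * g (l * n + l) + l)%N.

Definition growth_equiv (f g : nat -> nat) : Prop :=
  growth_le f g /\ growth_le g f.

(* Main.v *)
Require Import Defs.
From HB Require Import structures.
From mathcomp Require Import all_boot.
From mathcomp Require Import finmap boolp classical_sets functions cardinality.
From mathcomp Require Import ssralg ssrnum ssrint ring zify.

Set Implicit Arguments.
Unset Strict Implicit.
Unset Printing Implicit Defensive.

Local Open Scope group_scope.

(** Take for [G] the [d]-th power of the infinite dihedral group [D].  It is
generated by the [d] coordinate translations and [d] coordinate reflections,
and the translations of all coordinates form an abelian subgroup, which is the
kernel of the map to [{ffun 'I_d -> bool}] recording which coordinates reverse
the orientation of the line, hence has finite index.

In [D] the conjugates of the reflection fixing [0] are the reflections fixing
an integer ([conj_flip]): a class of linear growth, because word length is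
comparable with the translation part.  Let [flips] be the element of [G] with
this reflection in its first [c] coordinates and [1] in the others.  Its class
is a product of [c] such classes, so it should grow like [n ^ c].

For an arbitrary generating set [S] both bounds come from comparing word length
with translation parts.  A letter of [S] changes every translation part by at
most a constant [K] ([ball_coord_bound]), so the elements of the class in the
ball of radius [n] are determined by [c] integers of absolute value at most
[n * K], which bounds their number by [(2 * n * K + 1) ^ c].  Conversely, [L]
letters of [S] suffice for each standard generator, so translations by vectors
in [0 .. n - 1] have length at most [d * n * L] ([in_ball_dihedral_power]);
conjugating [flips] by those supported on the first [c] coordinates gives
[n ^ c] distinct elements of length linear in [n]. *)

(** * Balls for the word metric *)

Section Balls.
Variable G : groupType.
Implicit Types (S : {fset G}) (g x y : G) (U : set G).

(** Words of bounded size can be concatenated and inverted, whereas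
[word_length] is a minimum; all length estimates are therefore made with this
predicate and transferred by [word_length_leP]. *)
Definition in_ball S n g := exists2 m, (m <= n)%N & has_word_of_size S g m.

Lemma in_ball_le S m n g : (m <= n)%N -> in_ball S m g -> in_ball S n g.
Proof. by move=> le_mn [p le_pm]; exists p => //; apply: leq_trans le_mn. Qed.

Lemma in_ball_generator S x : x \in S -> in_ball S 1 x.
Proof.
move=> Sx; exists 1%N => //; exists [:: x]; split=> //; last exact: big_seq1.
by move=> y /[!inE]/eqP->; left.
Qed.

Lemma in_ball1 S : in_ball S 0 1.
Proof. by exists 0%N => //; exists [::]; split=> //; apply: big_nil. Qed.

Lemma in_ballM S m n x y :
  in_ball S m x -> in_ball S n y -> in_ball S (m + n) (x * y).
Proof.
move=> [p lepm [v [Sv vx sv]]] [q leqn [w [Sw wy sw]]].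
exists (p + q)%N; first exact: leq_add.
exists (v ++ w); split; last by rewrite size_cat sv sw.
- by move=> z; rewrite mem_cat => /orP[/Sv|/Sw].
- by rewrite /represents big_cat /= vx wy.
Qed.

Lemma in_ballV S n x : in_ball S n x -> in_ball S n x^-1.
Proof.
move=> [p lepn [w [Sw wx sw]]]; exists p => //.
exists [seq y^-1 | y <- rev w]; split; last by rewrite size_map size_rev.
- by move=> _ /mapP[y /[!mem_rev]/Sw Sy ->]; rewrite invgK; case: Sy; auto.
- rewrite /represents -{}wx big_map {Sw sw}.
  elim: w => [|y w IHw]; first by rewrite !big_nil invg1.
  by rewrite rev_cons big_rcons /= IHw big_cons invgM.
Qed.

Lemma in_ballX S n x k : in_ball S n x -> in_ball S (k * n) (x ^+ k).
Proof.
move=> Sx; elim: k => [|k IHk]; first exact: in_ball1.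
by rewrite expgS mulSn; apply: in_ballM.
Qed.

Lemma in_ball_prod S (I : Type) (r : seq I) (n : I -> nat) (F : I -> G) :
  (forall i, in_ball S (n i) (F i)) ->
  in_ball S (\sum_(i <- r) n i) (\prod_(i <- r) F i).
Proof.
move=> SF; elim: r => [|i r IHr]; first by rewrite !big_nil; apply: in_ball1.
by rewrite !big_cons; apply: in_ballM.
Qed.

Lemma word_length_leP S g n :
  generates S -> (word_length S g <= n)%N <-> in_ball S n g.
Proof.
move=> genS; rewrite /word_length; case: pselect => [exS|[]]; last first.
  by have [m Sm] := genS g; exists m; apply/asboolP.
case: ex_minnP => m /asboolP Sm min_m; split=> [le_mn|[p le_pn Sp]].
  by exists m.
by apply: leq_trans le_pn; apply/min_m/asboolP.
Qed.

Lemma growth_le_card S U n (T : finType) (f : T -> G) :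
  generates S -> (forall g, U g -> in_ball S n g -> exists t, g = f t) ->
  (growth U S n <= #|T|)%N.
Proof.
move=> genS Uf; rewrite /growth; set A := (X in fset_set X).
have subA : (A `<=` range f)%classic.
  move=> g [Ug /(word_length_leP _ _ genS)/(Uf g Ug)[t ->]]; exact: imageT.
have finf : finite_set (range f) by apply: finite_image.
have finA := sub_finite_set subA finf.
have : (fset_set A `<=` [fset f t | t in T])%fset.
  apply/fsubsetP => g; rewrite in_fset_set // inE => /subA[t _ <-].
  exact: in_imfset.
move/fsubset_leq_card/leq_trans; apply.
by apply: leq_trans (leq_imfset_card _ _ _) _; rewrite -cardE cardT.
Qed.

(** Finiteness is what makes [growth] count: without it [fset_set] could be
empty and no lower bound on [growth] would hold. *)
Lemma finite_ball S n : finite_set (in_ball S n).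
Proof.
pose gens := ([set` S] `|` [set x^-1 | x in [set` S]])%classic.
have fin_gens : finite_set gens.
  by rewrite finite_setU; split; [|apply: finite_image]; apply: finite_fset.
have fin_words m : finite_set [set g | has_word_of_size S g m]%classic.
  elim: m => [|m IHm].
    apply: sub_finite_set (finite_set1 1) => g [w [_ <- /size0nil->]].
    exact: big_nil.
  apply: sub_finite_set (finite_image2 (@mul G) fin_gens IHm) => g.
  case=> -[|x w] [Sw <- //= [sw]]; exists x.
    have [Sx|Sx] := Sw x (mem_head _ _); [by left | right].
    by exists x^-1; rewrite ?invgK.
  exists (\prod_(y <- w) y); last by rewrite big_cons.
  by exists w; split=> // y wy; apply: Sw; rewrite inE wy orbT.
have := bigcup_finite (finite_II n.+1) (fun m _ => fin_words m).
by apply: sub_finite_set => g [m le_mn Sg]; exists m.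
Qed.

Lemma growth_ge_card S U n (T : finType) (f : T -> G) :
    generates S -> injective f -> (forall t, U (f t)) ->
    (forall t, in_ball S n (f t)) ->
  (#|T| <= growth U S n)%N.
Proof.
move=> genS f_inj Uf Sf; rewrite /growth; set A := (X in fset_set X).
have finA : finite_set A.
  apply: sub_finite_set (finite_ball S n) => g.
  by move=> [_ /(word_length_leP _ _ genS)].
have subA : ([fset f t | t in T] `<=` fset_set A)%fset.
  apply/fsubsetP => _ /imfsetP[t _ ->]; rewrite in_fset_set // inE.
  by split; last exact/word_length_leP.
by apply: leq_trans (fsubset_leq_card subA); rewrite card_imfset //
  -cardE cardT.
Qed.

End Balls.

(** * The infinite dihedral group *)

Section Dihedral.
Import GRing.Theory.
Local Open Scope ring_scope.

(** The pair [(a, b)] is the isometry of the line sending [t] to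
[a + (-1) ^+ b * t]; the product below is composition.  The name makes it a
type distinct from the pair type, on which products are componentwise. *)
Definition dihedral : Type := int * bool.
HB.instance Definition _ := Choice.on dihedral.

Definition dihedral_mul (x y : dihedral) : dihedral :=
  (x.1 + (-1) ^+ x.2 * y.1, x.2 (+) y.2).

Definition dihedral_inv (x : dihedral) : dihedral :=
  (- ((-1) ^+ x.2 * x.1), x.2).

Definition dihedral_one : dihedral := (0, false).

Fact dihedral_mulA : associative dihedral_mul.
Proof.
move=> [a b] [a' b'] [a'' b'']; rewrite /dihedral_mul/=.
by rewrite addbA signr_addb; congr pair; ring.
Qed.

Fact dihedral_mul1g : left_id dihedral_one dihedral_mul.
Proof. by move=> [a b]; rewrite /dihedral_mul/= add0r mul1r. Qed.

Fact dihedral_mulg1 : right_id dihedral_one dihedral_mul.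
Proof. by move=> [a b]; rewrite /dihedral_mul/= mulr0 addr0 addbF. Qed.

Fact dihedral_mulVg : left_inverse dihedral_one dihedral_inv dihedral_mul.
Proof. by move=> [a b]; rewrite /dihedral_mul/= addNr addbb. Qed.

Fact dihedral_mulgV : right_inverse dihedral_one dihedral_inv dihedral_mul.
Proof.
by move=> [a b]; rewrite /dihedral_mul/= mulrN signrMK subrr addbb.
Qed.

HB.instance Definition _ := isGroup.Build dihedral dihedral_mulA dihedral_mul1g
  dihedral_mulg1 dihedral_mulVg dihedral_mulgV.

Definition shift (a : int) : dihedral := (a, false).
Definition flip (a : int) : dihedral := (a, true).

Lemma shiftX n : (shift 1 ^+ n)%g = shift n.
Proof.
elim: n => // n IHn; rewrite expgS IHn.
by congr pair; rewrite /= mul1r intS.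
Qed.

(** Normal form with respect to the two standard generators; the exponents bound
the word length of [x]. *)
Lemma dihedralE (x : dihedral) :
  x = ((if 0 <= x.1 then shift 1 else (shift 1)^-1)
         ^+ `|x.1|%N * flip 0 ^+ x.2)%g.
Proof.
have sE (b : bool) : (flip 0 ^+ b)%g = (0, b) by case: b.
rewrite sE; case: x => [[n|n] b] /=; rewrite ?expVgn shiftX.
  by congr pair; rewrite /= mulr0 addr0.
by congr pair; rewrite /= mulr0 addr0 mul1r NegzE.
Qed.

(** [flip 0] inverts translations, so conjugating it by a translation of [a]
moves it by twice [a] up to sign: this is what makes its class infinite and of
linear growth. *)
Lemma conj_flip (x : dihedral) :
  (flip 0 ^ x)%g = flip (- ((-1) ^+ x.2 * x.1 *+ 2)).
Proof.
case: x => a b; congr pair; rewrite /= ?add0r; first by case: b; ring.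
by case: b.
Qed.

Lemma dihedral_abszM (x y : dihedral) :
  (`|(x * y)%g.1|%N <= `|x.1|%N + `|y.1|%N)%N.
Proof. by rewrite -(abszMsign x.2 y.1) /=; lia. Qed.

Lemma dihedral_abszV (x : dihedral) : `|x^-1%g.1|%N = `|x.1|%N.
Proof. by rewrite /= abszN abszMsign. Qed.

End Dihedral.

(** * Powers of the infinite dihedral group *)

Section DihedralPower.
Variable d : nat.
Implicit Types (i : 'I_d) (x y : dihedral) (S : {fset {ffun 'I_d -> dihedral}}).
Local Notation G := {ffun 'I_d -> dihedral}.
Implicit Types g h : G.

Definition single i x : G := [ffun j => if j == i then x else 1].

Lemma singleM i : {morph single i : x y / x * y}.
Proof.
by move=> x y; apply/ffunP=> j; rewrite !ffunE; case: eqP; rewrite ?mulg1.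
Qed.

Lemma single1 i : single i 1 = 1.
Proof. by apply/ffunP=> j; rewrite !ffunE if_same. Qed.

Lemma singleX i n : {morph single i : x / x ^+ n}.
Proof.
by move=> x; elim: n => [|n IHn]; rewrite ?single1 // !expgS singleM IHn.
Qed.

Lemma singleV i : {morph single i : x / x^-1}.
Proof.
by move=> x; apply/ffunP=> j; rewrite !ffunE; case: eqP; rewrite ?invg1.
Qed.

Lemma prod_single g : g = \prod_i single i (g i).
Proof.
apply/ffunP=> j; rewrite (big_morph (fun h : G => h j) (id1 := 1) (op1 := mul)).
- rewrite (big_only1 j) => [|//|i /negPf neq_ij _]; rewrite ffunE ?eqxx //.
  by rewrite eq_sym neq_ij.
- by move=> g1 g2; rewrite ffunE.
- by rewrite ffunE.
Qed.

Definition translation i := single i (shift 1).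
Definition reflection i := single i (flip 0).

(** The constant [L] compares an arbitrary [S] with the standard generators. It
serves twice: with [L = 1] for finite generation, and with [S] arbitrary for the
lower bound on growth. *)
Lemma in_ball_dihedral_power S L g :
    (forall i, in_ball S L (translation i)) ->
    (forall i, in_ball S L (reflection i)) ->
  in_ball S (\sum_i (`|(g i).1|%N + (g i).2) * L) g.
Proof.
move=> St Sr; rewrite [X in in_ball _ _ X]prod_single; apply: in_ball_prod => i.
rewrite [X in single i X]dihedralE singleM !singleX mulnDl.
apply: in_ballM; apply: in_ballX; last exact: Sr.
by case: ifP => _; [apply: St | rewrite singleV; apply/in_ballV/St].
Qed.

Lemma finitely_generated_dihedral_power : finitely_generated G.
Proof.
exists ([fset translation i | i : 'I_d] `|`
        [fset reflection i | i : 'I_d])%fset.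
move=> g; set S := (X in has_word_of_size X).
have St i : in_ball S 1 (translation i).
  by apply: in_ball_generator; rewrite !inE in_imfset.
have Sr i : in_ball S 1 (reflection i).
  by apply: in_ball_generator; rewrite !inE orbC in_imfset.
by have [n _ Sg] := in_ball_dihedral_power g St Sr; exists n.
Qed.

Definition signs g : {ffun 'I_d -> bool} := [ffun i => (g i).2].

Lemma signsM g h i : signs (g * h) i = signs g i (+) signs h i.
Proof. by rewrite !ffunE. Qed.

Lemma signsV g : signs g^-1 = signs g.
Proof. by apply/ffunP=> i; rewrite !ffunE. Qed.

(** The subgroup is the group of translations; as the kernel of [signs], a
morphism to a finite group, it has the fibres of [signs] as its cosets. *)
Lemma virtually_abelian_dihedral_power : virtually_abelian G.
Proof.
pose H : set G := [set g | forall i, signs g i = false]%classic.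
exists H; split.
- split; first by rewrite inE => i; rewrite !ffunE.
  move=> g h; rewrite !inE => Hg Hh i.
  by rewrite signsM signsV Hg Hh.
- move=> g h Hg Hh; apply/ffunP=> i; move: (Hg i) (Hh i).
  rewrite !ffunE; case: (g i) (h i) => a ? [b ?] /= -> ->.
  by congr pair; rewrite /= !GRing.mul1r GRing.addrC.
- have cosetE g : left_coset g H = [set h | signs h = signs g]%classic.
    apply/seteqP; split=> [_ [h Hh <-]|h /= gh].
      by apply/ffunP=> i; rewrite signsM Hh addbF.
    exists (g^-1 * h); last by rewrite mulVKg.
    by move=> i; rewrite signsM signsV gh addbb.
  have fin : finite_set (range (fun k => [set h : G | signs h = k]%classic)).
    exact: finite_image.
  apply: sub_finite_set fin => _ [g _ <-]; rewrite cosetE.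
  by exists (signs g).
Qed.

(** The translation part is subadditive, so it grows at most linearly along a
word; [K] is its maximum over the letters and the coordinates. *)
Lemma ball_coord_bound S :
  exists K, forall n g, in_ball S n g -> forall i, (`|(g i).1|%N <= n * K)%N.
Proof.
pose K := (\max_(g <- S) \max_i `|(g i).1|%N)%N; exists K => n g.
have gens_le h i : h \in S -> (`|(h i).1|%N <= K)%N.
  move=> Sh; apply: (bigmaxn_sup_seq h) => //.
  exact: (leq_bigmax (F := fun i => `|(h i).1|%N)).
case=> m le_mn [w [Sw <- wm]] i; apply: leq_trans (leq_mul le_mn (leqnn K)).
rewrite -{m le_mn}wm; elim: w Sw => [|h w IHw] Sw.
  by rewrite big_nil ffunE.
rewrite big_cons ffunE (leq_trans (dihedral_abszM _ _)) // mulSn.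
apply: leq_add; last by apply: IHw => x wx; apply: Sw; rewrite inE wx orbT.
have [/gens_le //|/gens_le] := Sw h (mem_head _ _).
by move/(_ i); rewrite ffunE dihedral_abszV.
Qed.

(** * Growth of the conjugacy classes *)

Section Class.
Variable c : nat.
Hypothesis le_cd : (c <= d)%N.

(** The inclusion of the [c]-th power as the first [c] coordinates. *)
Definition pad (v : 'I_c -> dihedral) : G :=
  [ffun i : 'I_d => oapp v 1 (insub (val i))].

Lemma padE v j : pad v (widen_ord le_cd j) = v j.
Proof. by rewrite ffunE valK. Qed.

Lemma pad_conj v g : pad v ^ g = pad (fun j => v j ^ g (widen_ord le_cd j)).
Proof.
apply/ffunP=> i; rewrite !ffunE; case: insubP => [j _ ji|_] /=.
  by rewrite (_ : widen_ord le_cd j = i) //; apply: val_inj.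
by rewrite mul1g mulVg.
Qed.

Definition flips := pad (fun=> flip 0).

Definition flip_class : set G := [set flips ^ g | g in [set: G]]%classic.

Lemma growth_flip_class_le S : generates S ->
  growth_le (growth flip_class S) (fun n => n ^ c)%N.
Proof.
move=> genS; have [K SK] := ball_coord_bound S.
exists (2 * K).+1 => // n.
(* The ordinal [k j] encodes an integer between - n * K and n * K. *)
pose f (k : {ffun 'I_c -> 'I_(2 * (n * K)).+1}) : G :=
  pad (fun j => flip ((k j : int) - (n * K)%N%:Z)%R).
have := @growth_le_card _ S flip_class n _ f genS.
rewrite card_ffun !card_ord => le_growth.
apply: leq_trans (le_growth _) _.
  move=> _ [g _ <-] Sg; exists [ffun j : 'I_c =>
    inord `|(((flips ^ g)%g (widen_ord le_cd j)).1 + (n * K)%N%:Z)%R|%N].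
  rewrite [LHS]pad_conj; congr pad; apply/funext => j.
  have := SK _ _ Sg (widen_ord le_cd j).
  rewrite [finfun _ j]ffunE pad_conj padE conj_flip; move: (- _)%R => a /= le_a.
  by congr flip; rewrite inordK /=; move: (n * K)%N le_a; lia.
apply: leq_trans (leq_addr _ _); apply: leq_trans (leq_pmull _ _) => //.
(* For c = 0 both powers are 1, and [leq_exp2r] does not apply. *)
by case: (c) => // e; rewrite leq_exp2r //; lia.
Qed.

Lemma growth_flip_class_ge S : generates S ->
  growth_le (fun n => n ^ c)%N (growth flip_class S).
Proof.
move=> genS.
pose len := word_length S.
pose L := (\max_i maxn (len (translation i)) (len (reflection i)))%N.
have [Lt Lr] : (forall i, in_ball S L (translation i)) /\
               (forall i, in_ball S L (reflection i)).
  by split=> i; apply/word_length_leP => //; apply: (bigmaxn_sup_seq i);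
    rewrite ?mem_index_enum ?leq_maxl ?leq_maxr.
have Sx : in_ball S (len flips) flips by apply/word_length_leP.
(* The conjugate of [flips] by [t k] costs [t k] twice and [flips] once; [l] is
   positive as [growth_le] requires. *)
pose l := (2 * (d * L) + len flips).+1; exists l => // n.
pose t (k : {ffun 'I_c -> 'I_n}) := pad (fun j => shift (k j)%N).
have St k : in_ball S (d * (n * L)) (t k).
  apply: in_ball_le (in_ball_dihedral_power _ Lt Lr).
  apply: (@leq_trans (\sum_(i < d) n * L)); last first.
    by rewrite sum_nat_const card_ord.
  apply: leq_sum => i _; rewrite leq_mul2r ffunE; apply/orP; right.
  by case: insubP => [j _ _|_]; rewrite /= ?addn0 //; apply: ltnW.
apply: leq_trans (leq_addr _ _); apply: leq_trans (leq_pmull _ _) => //.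
(* The conjugate by [t k] has translation parts - 2 * k j, which recover [k]. *)
have := @growth_ge_card _ S flip_class (l * n + l) _ (fun k => flips ^ t k)
  genS.
rewrite card_ffun !card_ord; apply.
- move=> k k'; rewrite !pad_conj => eq_kk'; apply/ffunP=> j.
  have := congr1 (fun g : G => (g (widen_ord le_cd j)).1) eq_kk'.
  rewrite !padE !conj_flip /= => eq_j; apply/val_inj => /=; lia.
- by move=> k; exists (t k).
- move=> k; apply: (@in_ball_le _ _ (d * (n * L) + (len flips + d * (n * L)))).
    by rewrite /l; nia.
  by apply: in_ballM (in_ballV (St k)) _; apply: in_ballM.
Qed.

End Class.

End DihedralPower.

Theorem proposition3p10 (d : nat) :
  exists G : groupType,
    [/\ finitely_generated G, virtually_abelian G &
      forall c : nat, (c <= d)%N ->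
        exists2 C : set G, is_conjugacy_class C &
          forall S : {fset G}, generates S ->
            growth_equiv (growth C S) (fun n : nat => (n ^ c)%N)].
Proof.
exists {ffun 'I_d -> dihedral}; split.
- exact: finitely_generated_dihedral_power.
- exact: virtually_abelian_dihedral_power.
- move=> c le_cd; exists (@flip_class d c).
    by exists (@flips d c).
  move=> S genS; split; first exact: growth_flip_class_le.
  exact: growth_flip_class_ge.
Qed.
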